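(* Let $\mathbb{K}$ be a field of characteristic $\neq 2$. (1) Let $p,q\ge 0$. In $Cl(p+1,q+1)$ let $e,\tilde e$ be basis vectors with $e^2=1$, $\tilde e^2=-1$, let $Cl(p,q)\subset Cl(p+1,q+1)$ be the subalgebra generated by the remaining basis vectors, and put $P_\pm=\frac12(1\pm\tilde e e)$. For $a=P_+a_0^+ + P_+e\,a_1^+ + P_-a_0^- + P_-e\,a_1^-$ with $a_i^\pm\in Cl(p,q)$, put $\Phi(a)=\begin{bmatrix}a_0^+ & \alpha(a_1^+)\\ a_1^- & \alpha(a_0^-)\end{bmatrix}\in M_2(Cl(p,q))$. Then $$\Phi(\beta(a))=\begin{bmatrix}\beta(a_0^-) & \alpha(\beta(a_1^-))\\ \beta(a_1^+) & \alpha(\beta(a_0^+))\end{bmatrix}.$$ (2) There is an algorithm which, for $n\ge 1$ and $a\in Cl(n,n)$, computes the matrix $F_n(\beta(a))$ from the matrix $F_n(a)$ using $O(n\cdot 4^n)$ operations.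
   Context: $Cl(p,q)$ is the Clifford algebra over $\mathbb{K}$ generated by $p+q$ pairwise anticommuting basis vectors, $p$ of which square to $1$ and $q$ of which square to $-1$. In $Cl(n,n)$ the basis vectors are $e_0,\dots,e_{n-1}$ (squaring to $1$) and $\tilde e_0,\dots,\tilde e_{n-1}$ (squaring to $-1$), and $Cl(n-1,n-1)\subset Cl(n,n)$ is the subalgebra generated by the basis vectors with indices $0,\dots,n-2$. $\alpha$ is the parity automorphism: the algebra automorphism sending every basis vector $v$ to $-v$. $\beta$ is the algebra automorphism fixing every basis vector that squares to $1$ and sending every basis vector $v$ that squares to $-1$ to $-v$. The maps $F_n: Cl(n,n)\to M_{2^n}(\mathbb{K})$ (which are algebra isomorphisms) are defined recursively by $F_0(a)=(a)$ for $a\in Cl(0,0)=\mathbb{K}$ and, for $n\ge 1$ and $A_{ij}\in Cl(n-1,n-1)$, $$F_n(A_{00}+e_{n-1}A_{01}+\tilde e_{n-1}A_{10}+\tilde e_{n-1}e_{n-1}A_{11})=\begin{bmatrix}F_{n-1}(A_{00}+A_{11}) & F_{n-1}(\alpha(A_{01}+A_{10}))\\ F_{n-1}(A_{01}-A_{10}) & F_{n-1}(\alpha(A_{00}-A_{11}))\end{bmatrix}.$$ An operation means moving a matrix entry, changing its sign, or an arithmetic operation in $\mathbb{K}$, each at unit cost; the constant in $O(\cdot)$ is absolute. *)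

(* Defs.v *)
From HB Require Import structures.
From mathcomp Require Import all_boot all_order all_algebra.
From mathcomp Require Import ring.

Set Implicit Arguments.
Unset Strict Implicit.
Unset Printing Implicit Defensive.

Import GRing.Theory.
Local Open Scope ring_scope.

(** * Clifford algebras Cl(p,q)

    [inl i] indexes the basis vector e_i (square 1) and [inr j] the basis
    vector ~e_j (square -1).  An element of Cl(p,q) is its family of
    coordinates in the basis of the ordered monomials
      e_S = e_{i1} ... e_{ik} ~e_{j1} ... ~e_{jl},
    where S = {i1 < ... < ik} + {j1 < ... < jl}. *)

Notation idx p q := ('I_p + 'I_q)%type.

Definition Cl (K : fieldType) (p q : nat) : Type := {ffun {set idx p q} -> K^o}.

HB.instance Definition _ (K : fieldType) p q := GRing.Lmodule.on (Cl K p q).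

(* [cross x y]: bringing e_x ... e_y into normal form costs a sign, either
   because the two vectors are in the wrong order, or because x = y and
   e_x squares to -1. *)
Definition cross {p q} (x y : idx p q) : bool :=
  match x, y with
  | inl i, inl j => (j < i)%N
  | inl _, inr _ => false
  | inr _, inl _ => true
  | inr i, inr j => (j <= i)%N
  end.

Definition symd {T : finType} (A B : {set T}) : {set T} :=
  [set x | (x \in A) (+) (x \in B)].

(* e_S * e_T = tw S T * e_(symd S T) *)
Definition tw (K : fieldType) p q (S T : {set idx p q}) : K :=
  (-1) ^+ (\sum_(x in S) \sum_(y in T) cross x y)%N.

Definition mon {K : fieldType} {p q} (S : {set idx p q}) : Cl K p q :=
  [ffun T => (T == S)%:R].

(* The product e_S * e_T contributes to the coordinate U iff T = symd S U. *)
Definition cl_mul {K : fieldType} {p q} (a b : Cl K p q) : Cl K p q :=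
  [ffun U => \sum_S a S * b (symd S U) * tw K S (symd S U)].

Section SymDiff.
Variable T : finType.
Implicit Types A B C : {set T}.

Lemma symdA A B C : symd A (symd B C) = symd (symd A B) C.
Proof. by apply/setP=> x; rewrite !inE addbA. Qed.
Lemma symdC A B : symd A B = symd B A.
Proof. by apply/setP=> x; rewrite !inE addbC. Qed.
Lemma symdxx A : symd A A = set0.
Proof. by apply/setP=> x; rewrite !inE addbb. Qed.
Lemma symd0 A : symd A set0 = A.
Proof. by apply/setP=> x; rewrite !inE addbF. Qed.
Lemma sym0d A : symd set0 A = A.
Proof. by rewrite symdC symd0. Qed.
Lemma symdK A : involutive (symd A).
Proof. by move=> B; rewrite symdA symdxx sym0d. Qed.
End SymDiff.

Section Ring.
Variables (K : fieldType) (p q : nat).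
Implicit Types (S T U : {set idx p q}) (a b c : Cl K p q).

Lemma twE S T :
  tw K S T = \prod_x \prod_y (-1) ^+ [&& x \in S, y \in T & cross x y].
Proof.
rewrite /tw expr_sum [LHS]big_mkcond; apply: eq_bigr => x _.
case: (x \in S); last by rewrite big1.
rewrite expr_sum [LHS]big_mkcond; apply: eq_bigr => y _.
by case: (y \in T).
Qed.

Lemma tw_symdr S T U : tw K S (symd T U) = tw K S T * tw K S U.
Proof.
rewrite !twE -big_split; apply: eq_bigr => x _.
rewrite -big_split; apply: eq_bigr => y _; rewrite inE.
by case: (x \in S) (y \in T) (y \in U) (cross x y) => [] [] [] [];
  rewrite /= ?expr0 ?expr1 ?mulrNN ?mulr1 ?mul1r.
Qed.

Lemma tw_symdl S T U : tw K (symd S T) U = tw K S U * tw K T U.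
Proof.
rewrite !twE -big_split; apply: eq_bigr => x _.
rewrite -big_split; apply: eq_bigr => y _; rewrite inE.
by case: (x \in S) (x \in T) (y \in U) (cross x y) => [] [] [] [];
  rewrite /= ?expr0 ?expr1 ?mulrNN ?mulr1 ?mul1r.
Qed.

Lemma tw0s S : tw K set0 S = 1.
Proof. by rewrite /tw big_set0. Qed.
Lemma tws0 S : tw K S set0 = 1.
Proof. by rewrite /tw big1 // => x _; rewrite big_set0. Qed.
Lemma tw_sqr S T : tw K S T * tw K S T = 1.
Proof. by rewrite -tw_symdr symdxx tws0. Qed.
Lemma tw11 (x y : idx p q) : tw K [set x] [set y] = (-1) ^+ (cross x y : nat).
Proof. by rewrite /tw !big_set1. Qed.

Lemma cl_mulA : associative (@cl_mul K p q).
Proof.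
move=> a b c; apply/ffunP=> U; rewrite !ffunE.
under eq_bigr => S _ do rewrite ffunE mulr_sumr mulr_suml.
under [RHS]eq_bigr => S _ do rewrite ffunE !mulr_suml.
rewrite [RHS]exchange_big; apply: eq_bigr => S _ /=.
rewrite [RHS](reindex_inj (inv_inj (symdK S))); apply: eq_bigr => T _ /=.
rewrite symdK -symdA [symd T (symd S U)]symdA [symd T S]symdC -symdA.
set W := symd S (symd T U).
have -> : symd S U = symd T W.
  by rewrite /W symdA [symd T S]symdC -symdA symdK.
by rewrite tw_symdr tw_symdl; ring.
Qed.

Lemma mon_mulE S b U :
  cl_mul (mon S) b U = b (symd S U) * tw K S (symd S U).
Proof.
rewrite ffunE (bigD1 S) //= ffunE eqxx mul1r big1 ?addr0 // => T nTS.
by rewrite ffunE (negPf nTS) !mul0r.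
Qed.

Lemma cl_mul1 : left_id (mon set0) (@cl_mul K p q).
Proof. by move=> a; apply/ffunP=> U; rewrite mon_mulE sym0d tw0s mulr1. Qed.

Lemma cl_1mul : right_id (mon set0) (@cl_mul K p q).
Proof.
move=> a; apply/ffunP=> U; rewrite ffunE (bigD1 U) //=.
rewrite symdxx tws0 ffunE eqxx !mulr1 big1 ?addr0 // => T nTU.
rewrite ffunE; case: eqP => [E|_]; last by rewrite mulr0 mul0r.
by case/eqP: nTU; rewrite -(symdK T U) E symd0.
Qed.

Lemma cl_mulDl : left_distributive (@cl_mul K p q) +%R.
Proof.
move=> a b c; apply/ffunP=> U; rewrite !ffunE -big_split.
by apply: eq_bigr => S _; rewrite /= !ffunE !mulrDl.
Qed.

Lemma cl_mulDr : right_distributive (@cl_mul K p q) +%R.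
Proof.
move=> a b c; apply/ffunP=> U; rewrite !ffunE -big_split.
by apply: eq_bigr => S _; rewrite /= !ffunE mulrDr mulrDl.
Qed.

Lemma cl_1neq0 : mon set0 != 0 :> Cl K p q.
Proof.
apply/eqP => /ffunP/(_ set0); rewrite !ffunE eqxx => /eqP.
by rewrite oner_eq0.
Qed.

End Ring.

HB.instance Definition _ (K : fieldType) p q := GRing.Zmodule_isNzRing.Build (Cl K p q)
  (@cl_mulA K p q) (@cl_mul1 K p q) (@cl_1mul K p q)
  (@cl_mulDl K p q) (@cl_mulDr K p q) (@cl_1neq0 K p q).

Fact cl_scalerAl (K : fieldType) p q (k : K) (a b : Cl K p q) : k *: (a * b) = (k *: a) * b.
Proof.
apply/ffunP=> U; rewrite !ffunE scaler_sumr; apply: eq_bigr => S _.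
by rewrite !ffunE /GRing.scale /= !mulrA.
Qed.

HB.instance Definition _ (K : fieldType) p q :=
  GRing.Lmodule_isLalgebra.Build K (Cl K p q) (@cl_scalerAl K p q).

Fact cl_scalerAr (K : fieldType) p q (k : K) (a b : Cl K p q) : k *: (a * b) = a * (k *: b).
Proof.
apply/ffunP=> U; rewrite !ffunE scaler_sumr; apply: eq_bigr => S _.
by rewrite !ffunE /GRing.scale /=; ring.
Qed.

HB.instance Definition _ (K : fieldType) p q :=
  GRing.Lalgebra_isAlgebra.Build K (Cl K p q) (@cl_scalerAr K p q).

Definition bvec {K : fieldType} {p q} (x : idx p q) : Cl K p q := mon [set x].
Definition e {K : fieldType} {p q} (i : 'I_p) : Cl K p q := bvec (inl i).
Definition et {K : fieldType} {p q} (j : 'I_q) : Cl K p q := bvec (inr j).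

Section Presentation.
Variables (K : fieldType) (p q : nat).
Implicit Types (S T : {set idx p q}) (a b : Cl K p q) (x y : idx p q).

Lemma monM S T : mon S * mon T = tw K S T *: mon (symd S T).
Proof.
apply/ffunP=> U; rewrite mon_mulE !ffunE mulrC /GRing.scale /=.
have -> : (symd S U == T) = (U == symd S T).
  by rewrite (can2_eq (symdK S) (symdK S)).
by case: eqP => [->|]; rewrite ?symdK ?mulr0.
Qed.

Lemma e_sqr (i : 'I_p) : e i * e i = 1 :> Cl K p q.
Proof. by rewrite /e /bvec monM symdxx tw11 /= ltnn expr0 scale1r. Qed.

Lemma et_sqr (j : 'I_q) : et j * et j = -1 :> Cl K p q.
Proof. by rewrite /et /bvec monM symdxx tw11 /= leqnn expr1 scaleN1r. Qed.

Lemma bvec_anticomm x y : x != y -> bvec x * bvec y = - (bvec y * bvec x) :> Cl K p q.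
Proof.
move=> nxy; rewrite /bvec !monM !tw11 symdC -scaleNr; congr (_ *: _).
have -> : cross x y = ~~ cross y x.
  case: x y nxy => [i|i] [j|j] //= nij; last rewrite -ltnNge; first rewrite -leqNgt.
    by rewrite [RHS]leq_eqVlt; case: eqP => // /val_inj ji; rewrite ji eqxx in nij.
  by rewrite leq_eqVlt; case: eqP => // /val_inj ji; rewrite ji eqxx in nij.
by case: (cross y x); rewrite /= ?expr0 ?expr1 ?opprK.
Qed.

Lemma cl_sum_mon a : a = \sum_S a S *: mon S.
Proof.
apply/ffunP=> T; rewrite sum_ffunE (bigD1 T) //= !ffunE eqxx /GRing.scale /= mulr1.
by rewrite big1 ?addr0 // => S nST; rewrite !ffunE eq_sym (negPf nST) scaler0.
Qed.

Lemma bvec_ind (P : Cl K p q -> Prop) :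
  P 1 -> (forall x, P (bvec x)) -> (forall a b, P a -> P b -> P (a * b)) ->
  (forall k a b, P a -> P b -> P (k *: a + b)) -> forall a, P a.
Proof.
move=> P1 Pv PM PL a.
have PZ k b : P b -> P (k *: b).
  move=> Pb; have P0 : P 0 by rewrite -[0](addNr (1 : Cl K p q)) -scaleN1r; apply: PL.
  by rewrite -[_ *: _]addr0; apply: PL.
have Pmon S : P (mon S).
  have [n] := ubnP #|S|; elim: n S => // n IH S leSn.
  have [->|[x xS]] := set_0Vmem S; first exact: P1.
  have E : symd [set x] (S :\ x) = S.
    apply/setP=> y; rewrite !inE; case: eqP => [->|_]; rewrite ?xS //=.
  have -> : mon S = tw K [set x] (S :\ x) *: (bvec x * mon (S :\ x)).
    by rewrite /bvec monM E scalerA tw_sqr scale1r.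
  by apply/PZ/PM => //; apply: IH; move: leSn; rewrite (cardsD1 x) xS.
rewrite [a]cl_sum_mon; elim/big_rec: _ => [|S b _ Pb]; last exact: PL (Pmon S) Pb.
by rewrite -(scale0r 1); apply: PZ.
Qed.

End Presentation.

(** ** The automorphisms [alpha] and [beta] *)

(* The automorphism v |-> -v on the basis vectors selected by P and v |-> v on
   the others. *)
Definition sign_aut {K : fieldType} {p q} (P : pred (idx p q)) (a : Cl K p q) :
  Cl K p q := [ffun S : {set idx p q} => (-1) ^+ (\sum_(x in S) P x)%N * a S].

Definition alpha {K : fieldType} {p q} : Cl K p q -> Cl K p q :=
  sign_aut predT.

Definition sqr_neg {p q} (x : idx p q) : bool := if x is inr _ then true else false.

Definition beta {K : fieldType} {p q} : Cl K p q -> Cl K p q :=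
  sign_aut sqr_neg.

Section SignAut.
Variables (K : fieldType) (p q : nat) (P : pred (idx p q)).
Implicit Types (S T U : {set idx p q}) (a b : Cl K p q).

Fact sign_aut_zmod : zmod_morphism (@sign_aut K p q P).
Proof. by move=> a b; apply/ffunP=> S; rewrite !ffunE mulrBr. Qed.

Fact sign_aut_scalable : scalable (@sign_aut K p q P).
Proof. by move=> k a; apply/ffunP=> S; rewrite !ffunE /GRing.scale /=; ring. Qed.

Let sgn S : K := (-1) ^+ (\sum_(x in S) P x)%N.

Let sgn_symd S T : sgn (symd S T) = sgn S * sgn T.
Proof.
rewrite /sgn !expr_sum !(big_mkcond (fun x => x \in _)) -big_split.
apply: eq_bigr => x _; rewrite inE.
by case: (x \in S) (x \in T) (P x) => [] [] [];
  rewrite /= ?expr0 ?expr1 ?mulrNN ?mulr1 ?mul1r.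
Qed.

Fact sign_aut_monoid : monoid_morphism (@sign_aut K p q P).
Proof.
split=> [|a b].
  apply/ffunP=> S; rewrite !ffunE; case: eqP => [->|_]; last by rewrite mulr0.
  by rewrite big_set0 expr0 mulr1.
apply/ffunP=> U; rewrite !ffunE mulr_sumr; apply: eq_bigr => S _.
rewrite !ffunE -!/(sgn _) -[in LHS](symdK S U) sgn_symd.
rewrite (symdK S U); ring.
Qed.

HB.instance Definition _ :=
  GRing.isZmodMorphism.Build (Cl K p q) (Cl K p q) (@sign_aut K p q P)
    sign_aut_zmod.
HB.instance Definition _ :=
  GRing.isMonoidMorphism.Build (Cl K p q) (Cl K p q) (@sign_aut K p q P)
    sign_aut_monoid.
HB.instance Definition _ :=
  GRing.isScalable.Build K (Cl K p q) (Cl K p q) *:%R (@sign_aut K p q P)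
    sign_aut_scalable.

Lemma sign_autK : involutive (@sign_aut K p q P).
Proof. by move=> a; apply/ffunP=> S; rewrite !ffunE signrMK. Qed.

Lemma sign_aut_bvec x :
  sign_aut P (bvec x) = (if P x then - bvec x else bvec x) :> Cl K p q.
Proof.
apply/ffunP=> S; rewrite !ffunE; case: eqP => [->|nS].
  by rewrite big_set1 mulr1; case: (P x); rewrite !ffunE eqxx.
by rewrite mulr0; case: (P x); rewrite !ffunE; case: eqP; rewrite ?oppr0.
Qed.

End SignAut.

HB.instance Definition _ (K : fieldType) p q :=
  GRing.LRMorphism.copy (@alpha K p q) (sign_aut predT).
HB.instance Definition _ (K : fieldType) p q :=
  GRing.LRMorphism.copy (@beta K p q) (sign_aut sqr_neg).

Section AlphaBeta.
Variables (K : fieldType) (p q : nat).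

Lemma alphaK : involutive (@alpha K p q).
Proof. exact: sign_autK. Qed.
Lemma betaK : involutive (@beta K p q).
Proof. exact: sign_autK. Qed.
Lemma alpha_e i : alpha (e i) = - e i :> Cl K p q.
Proof. exact: sign_aut_bvec. Qed.
Lemma alpha_et j : alpha (et j) = - et j :> Cl K p q.
Proof. exact: sign_aut_bvec. Qed.
Lemma beta_e i : beta (e i) = e i :> Cl K p q.
Proof. exact: sign_aut_bvec. Qed.
Lemma beta_et j : beta (et j) = - et j :> Cl K p q.
Proof. exact: sign_aut_bvec. Qed.

Lemma cl_morph_uniq (B : algType K) (f g : {lrmorphism Cl K p q -> B}) :
  (forall i, f (e i) = g (e i)) -> (forall j, f (et j) = g (et j)) -> f =1 g.
Proof.
move=> fe fet; elim/bvec_ind => [|[i|j]|a b IHa IHb|k a b IHa IHb].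
- by rewrite !rmorph1.
- exact: fe.
- exact: fet.
- by rewrite !rmorphM /= IHa IHb.
- by rewrite !linearP /= IHa IHb.
Qed.

End AlphaBeta.

(** ** The inclusion of Cl(p,q) in Cl(p+1,q+1)

    [incl i j] embeds Cl(p,q) as the subalgebra of Cl(p+1,q+1) generated by the
    basis vectors other than [e i] and [et j], preserving their order. *)

Definition shift {p q} (i : 'I_p.+1) (j : 'I_q.+1) (x : idx p q) :
    idx p.+1 q.+1 :=
  match x with inl k => inl (lift i k) | inr k => inr (lift j k) end.

Definition incl {K : fieldType} {p q} (i : 'I_p.+1) (j : 'I_q.+1)
    (a : Cl K p q) : Cl K p.+1 q.+1 :=
  [ffun S : {set idx p.+1 q.+1} =>
    if (inl i \in S) || (inr j \in S) then 0 else a (shift i j @^-1: S)].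

Section Incl.
Variables (K : fieldType) (p q : nat) (i : 'I_p.+1) (j : 'I_q.+1).
Implicit Types (S T : {set idx p q}) (U V : {set idx p.+1 q.+1}).
Implicit Types (a b : Cl K p q) (x y : idx p q).

Let off U := (inl i \in U) || (inr j \in U).

Lemma shift_inj : injective (@shift p q i j).
Proof.
by move=> [x|x] [y|y] //= [] /(can_inj (bumpK _)) xy; congr (_ _); apply: val_inj.
Qed.

Lemma cross_shift x y : cross (shift i j x) (shift i j y) = cross x y.
Proof. by case: x y => x [] y //=; rewrite ?leq_bump2 // !ltnNge leq_bump2. Qed.

Lemma shift_neq_i x : shift i j x != inl i.
Proof. by case: x => x //; rewrite (inj_eq inl_inj) eq_sym neq_lift. Qed.

Lemma shift_neq_j x : shift i j x != inr j.
Proof. by case: x => x //; rewrite (inj_eq inr_inj) eq_sym neq_lift. Qed.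

Lemma shiftP z : [\/ z = inl i, z = inr j | exists x, z = shift i j x].
Proof.
case: z => z.
  case: (unliftP i z) => [x ->|->]; last by constructor 1.
  by constructor 3; exists (inl x).
case: (unliftP j z) => [x ->|->]; last by constructor 2.
by constructor 3; exists (inr x).
Qed.

Lemma mem_shift_i S : (inl i \in shift i j @: S) = false.
Proof. by apply/imsetP => -[x _ /eqP]; rewrite eq_sym (negPf (shift_neq_i x)). Qed.

Lemma mem_shift_j S : (inr j \in shift i j @: S) = false.
Proof. by apply/imsetP => -[x _ /eqP]; rewrite eq_sym (negPf (shift_neq_j x)). Qed.

Let mem_shift S x : (shift i j x \in shift i j @: S) = (x \in S).
Proof. exact/mem_imset/shift_inj. Qed.

Lemma shift_preK S : shift i j @^-1: (shift i j @: S) = S.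
Proof. by apply/setP=> x; rewrite inE mem_shift. Qed.

Lemma preshiftK U : ~~ off U -> shift i j @: (shift i j @^-1: U) = U.
Proof.
rewrite negb_or => /andP[iU jU]; apply/setP=> z.
have [->|->|[x ->]] := shiftP z.
- by rewrite mem_shift_i (negPf iU).
- by rewrite mem_shift_j (negPf jU).
- by rewrite mem_shift inE.
Qed.

Let off_shift S : off (shift i j @: S) = false.
Proof. by rewrite /off mem_shift_i mem_shift_j. Qed.

Lemma symd_shift S T :
  symd (shift i j @: S) (shift i j @: T) = shift i j @: (symd S T).
Proof.
apply/setP=> z; rewrite inE.
have [->|->|[x ->]] := shiftP z; rewrite ?mem_shift_i ?mem_shift_j //.
by rewrite !mem_shift inE.
Qed.

Lemma tw_shift S T : tw K (shift i j @: S) (shift i j @: T) = tw K S T.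
Proof.
rewrite /tw; congr (_ ^+ _); rewrite big_imset /=; last by move=> ? ? _ _ /shift_inj.
apply: eq_bigr => x _; rewrite big_imset /=; last by move=> ? ? _ _ /shift_inj.
by apply: eq_bigr => y _; rewrite cross_shift.
Qed.

Lemma inclE a U : incl i j a U = if off U then 0 else a (shift i j @^-1: U).
Proof. by rewrite ffunE. Qed.

Lemma incl_shift a S : incl i j a (shift i j @: S) = a S.
Proof. by rewrite inclE off_shift shift_preK. Qed.

Fact incl_zmod : zmod_morphism (@incl K p q i j).
Proof.
by move=> a b; apply/ffunP=> S; rewrite !ffunE; case: ifP; rewrite ?subr0 // !ffunE.
Qed.

Fact incl_scalable : scalable (@incl K p q i j).
Proof.
by move=> k a; apply/ffunP=> S; rewrite !ffunE; case: ifP; rewrite ?scaler0.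
Qed.

Fact incl_monoid : monoid_morphism (@incl K p q i j).
Proof.
split=> [|a b].
  apply/ffunP=> U; rewrite inclE !ffunE; case: ifP => [|/negbT nU].
    by case: eqP => // ->; rewrite /off !inE.
  rewrite -{2}(preshiftK nU); congr (_ %:R : K); congr (nat_of_bool _).
  by rewrite -(inj_eq (imset_inj shift_inj)) imset0.
apply/ffunP=> U; rewrite inclE [RHS]ffunE; case: ifP => [oU|/negbT nU].
  rewrite big1 // => V _; rewrite !inclE.
  case: ifP => [|nV]; first by rewrite !mul0r.
  case: ifP => [|nVU]; first by rewrite mulr0 mul0r.
  by move: oU nV nVU; rewrite /off !inE; do 4!case: (_ \in _).
rewrite [RHS](bigID off) /= [X in _ = X + _]big1 ?add0r; last first.
  by move=> V oV; rewrite inclE oV !mul0r.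
rewrite ffunE (reindex_onto (fun S => shift i j @: S) (fun V => shift i j @^-1: V));
  last by move=> V /preshiftK.
apply: eq_big => [S|S _]; first by rewrite off_shift shift_preK eqxx.
by rewrite -(preshiftK nU) symd_shift !incl_shift tw_shift shift_preK.
Qed.

HB.instance Definition _ :=
  GRing.isZmodMorphism.Build (Cl K p q) (Cl K p.+1 q.+1) (@incl K p q i j)
    incl_zmod.
HB.instance Definition _ :=
  GRing.isMonoidMorphism.Build (Cl K p q) (Cl K p.+1 q.+1) (@incl K p q i j)
    incl_monoid.
HB.instance Definition _ :=
  GRing.isScalable.Build K (Cl K p q) (Cl K p.+1 q.+1) *:%R (@incl K p q i j)
    incl_scalable.

Lemma incl_inj : injective (@incl K p q i j).
Proof. by move=> a b ab; apply/ffunP=> S; rewrite -[LHS]incl_shift ab incl_shift. Qed.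

Let incl_bvec x : incl i j (bvec x) = bvec (shift i j x) :> Cl K p.+1 q.+1.
Proof.
apply/ffunP=> U; rewrite inclE !ffunE; case: ifP => [|/negbT nU].
  case: eqP => // ->; rewrite /off !inE ![_ == shift _ _ _]eq_sym.
  by rewrite (negPf (shift_neq_i x)) (negPf (shift_neq_j x)).
rewrite -{2}(preshiftK nU) -imset_set1; congr (_ %:R : K); congr (nat_of_bool _).
by rewrite (inj_eq (imset_inj shift_inj)).
Qed.

Lemma incl_e k : incl i j (e k) = e (lift i k) :> Cl K p.+1 q.+1.
Proof. exact: incl_bvec. Qed.

Lemma incl_et k : incl i j (et k) = et (lift j k) :> Cl K p.+1 q.+1.
Proof. exact: incl_bvec. Qed.

End Incl.

(** ** The decomposition A00 + e A01 + ~e A10 + ~e e A11 *)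

Definition glue {K : fieldType} {p q} (i : 'I_p.+1) (j : 'I_q.+1)
    (w : Cl K p q * Cl K p q * Cl K p q * Cl K p q) : Cl K p.+1 q.+1 :=
  let: (A00, A01, A10, A11) := w in
  incl i j A00 + e i * incl i j A01 + et j * incl i j A10
    + et j * e i * incl i j A11.

Section Glue.
Variables (K : fieldType) (p q : nat) (i : 'I_p.+1) (j : 'I_q.+1).
Implicit Types (S T : {set idx p q}) (U V : {set idx p.+1 q.+1}).
Implicit Types (a b : Cl K p q) (x y : idx p q).

Let et_e : et j * e i = - mon [set inr j; inl i] :> Cl K p.+1 q.+1.
Proof.
rewrite /et /e /bvec monM tw11 /= expr1 scaleN1r; congr (- mon _).
by apply/setP=> z; rewrite !inE; case: eqP => [->|].
Qed.

Let mon_incl (X U : {set idx p.+1 q.+1}) a : X \subset [set inr j; inl i] ->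
  (mon X * incl i j a) U =
  if [&& (inl i \in U) == (inl i \in X) & (inr j \in U) == (inr j \in X)]
  then a (shift i j @^-1: U) * tw K X (shift i j @: (shift i j @^-1: U))
  else 0.
Proof.
move=> /subsetP sX; rewrite mon_mulE inclE !inE.
have E : shift i j @^-1: symd X U = shift i j @^-1: U.
  apply/setP=> x; rewrite !inE; case: (boolP (_ \in X)) => // /sX.
  by rewrite !inE (negPf (shift_neq_i _ _ _)) (negPf (shift_neq_j _ _ _)).
rewrite E.
have [ci|ci] := boolP ((inl i \in X) (+) (inl i \in U)).
  by rewrite /= mul0r; move: ci; do 2!case: (inl i \in _).
have [cj|cj] := boolP ((inr j \in X) (+) (inr j \in U)).
  by rewrite /= mul0r; move: cj; do 2!case: (inr j \in _); rewrite /= ?andbF.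
rewrite /=; have -> : [&& (inl i \in U) == (inl i \in X) & (inr j \in U) == (inr j \in X)].
  by move: ci cj; do 4!case: (_ \in _).
rewrite -E preshiftK // !inE negb_or; exact/andP.
Qed.

Let glueE A00 A01 A10 A11 U : glue i j (A00, A01, A10, A11) U =
  let ci := inl i \in U in let cj := inr j \in U in
  let S := shift i j @^-1: U in let V := shift i j @: S in
  if ci then if cj then - (A11 S * tw K [set inr j; inl i] V)
             else A01 S * tw K [set inl i] V
  else if cj then A10 S * tw K [set inr j] V else A00 S.
Proof.
have si : [set inl i : idx p.+1 q.+1] \subset [set inr j; inl i].
  by apply/subsetP=> z; rewrite !inE => ->; rewrite orbT.
have sj : [set inr j : idx p.+1 q.+1] \subset [set inr j; inl i].
  by apply/subsetP=> z; rewrite !inE => ->.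
have clD (a b : Cl K p.+1 q.+1) : (a + b) U = a U + b U by rewrite ffunE.
have clN (a : Cl K p.+1 q.+1) : (- a) U = - a U by rewrite ffunE.
rewrite /glue et_e mulNr !clD clN inclE !mon_incl // !inE !eqxx /=.
by case: (inl i \in U) (inr j \in U) => [] []; rewrite /= ?oppr0 ?addr0 ?add0r ?oppr0.
Qed.

Let tw_cancel X V (k : K) : k * tw K X V * tw K X V = k.
Proof. by rewrite -mulrA tw_sqr mulr1. Qed.

Let eqs := (inE, mem_shift_i, mem_shift_j, eqxx).

Let pre_add (X : {set idx p.+1 q.+1}) S : X \subset [set inr j; inl i] ->
  shift i j @^-1: symd X (shift i j @: S) = S.
Proof.
move=> /subsetP sX; rewrite -[RHS](shift_preK i j); apply/setP=> x.
rewrite !inE; case: (boolP (_ \in X)) => // /sX.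
by rewrite !inE (negPf (shift_neq_i _ _ _)) (negPf (shift_neq_j _ _ _)).
Qed.

Lemma glue_inj : injective (@glue K p q i j).
Proof.
move=> [[[A00 A01] A10] A11] [[[B00 B01] B10] B11] /ffunP AB.
have si : [set inl i : idx p.+1 q.+1] \subset [set inr j; inl i].
  by apply/subsetP=> z; rewrite !inE => ->; rewrite orbT.
have sj : [set inr j : idx p.+1 q.+1] \subset [set inr j; inl i].
  by apply/subsetP=> z; rewrite !inE => ->.
congr (_, _, _, _); apply/ffunP=> S.
- have := AB (symd set0 (shift i j @: S)); rewrite !glueE !pre_add ?sub0set //.
  by rewrite !eqs.
- have := AB (symd [set inl i] (shift i j @: S)); rewrite !glueE !pre_add //.
  by rewrite !eqs /= => E; rewrite -[LHS](tw_cancel [set inl i] (shift i j @: S)) E tw_cancel.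
- have := AB (symd [set inr j] (shift i j @: S)); rewrite !glueE !pre_add //.
  by rewrite !eqs /= => E; rewrite -[LHS](tw_cancel [set inr j] (shift i j @: S)) E tw_cancel.
have := AB (symd [set inr j; inl i] (shift i j @: S)); rewrite !glueE !pre_add //.
rewrite !eqs /= => /oppr_inj E.
by rewrite -[LHS](tw_cancel [set inr j; inl i] (shift i j @: S)) E tw_cancel.
Qed.

Lemma glue_onto (a : Cl K p.+1 q.+1) : exists w, a == glue i j w.
Proof.
pose c (X : {set idx p.+1 q.+1}) : Cl K p q :=
  [ffun S : {set idx p q} => a (symd X (shift i j @: S)) * tw K X (shift i j @: S)].
have E (X U : {set idx p.+1 q.+1}) :
    (inl i \in X) = (inl i \in U) -> (inr j \in X) = (inr j \in U) ->
    X \subset [set inr j; inl i] ->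
    symd X (shift i j @: (shift i j @^-1: U)) = U.
  move=> ci cj /subsetP sX; apply/setP=> z; rewrite inE.
  have [->|->|[x ->]] := shiftP i j z; rewrite ?mem_shift_i ?mem_shift_j ?addbF //.
  rewrite mem_imset ?inE; last exact: shift_inj.
  case: (boolP (_ \in X)) => // /sX.
  by rewrite !inE (negPf (shift_neq_i _ _ _)) (negPf (shift_neq_j _ _ _)).
exists (c set0, c [set inl i], c [set inr j], - c [set inr j; inl i]).
apply/eqP/ffunP=> U; rewrite glueE /= !ffunE mulNr opprK !tw_cancel tw0s mulr1.
have si : [set inl i : idx p.+1 q.+1] \subset [set inr j; inl i].
  by apply/subsetP=> z; rewrite !inE => ->; rewrite orbT.
have sj : [set inr j : idx p.+1 q.+1] \subset [set inr j; inl i].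
  by apply/subsetP=> z; rewrite !inE => ->.
by case: ifP => ci; case: ifP => cj; rewrite E ?sub0set // ?inE ?eqxx ?ci ?cj.
Qed.

End Glue.

(** ** The isomorphism [Phi] from Cl(p+1,q+1) to M_2(Cl(p,q)) *)

Definition mx2 {R : Type} (a b c d : R) : 'M[R]_2 :=
  \matrix_(r < 2, s < 2)
    if r == 0 then if s == 0 then a else b else if s == 0 then c else d.

Definition Ppos {K : fieldType} {p q} (i : 'I_p.+1) (j : 'I_q.+1) :
  Cl K p.+1 q.+1 := 2^-1 *: (1 + et j * e i).
Definition Pneg {K : fieldType} {p q} (i : 'I_p.+1) (j : 'I_q.+1) :
  Cl K p.+1 q.+1 := 2^-1 *: (1 - et j * e i).

Definition pglue {K : fieldType} {p q} (i : 'I_p.+1) (j : 'I_q.+1)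
    (w : Cl K p q * Cl K p q * Cl K p q * Cl K p q) : Cl K p.+1 q.+1 :=
  let: (a0p, a1p, a0m, a1m) := w in
  Ppos i j * incl i j a0p + Ppos i j * e i * incl i j a1p
    + Pneg i j * incl i j a0m + Pneg i j * e i * incl i j a1m.

Section Pglue.
Variables (K : fieldType) (p q : nat) (i : 'I_p.+1) (j : 'I_q.+1).
Implicit Types (a b : Cl K p q).

Let pglueE (a0p a1p a0m a1m : Cl K p q) : pglue i j (a0p, a1p, a0m, a1m) =
  glue i j (2^-1 *: (a0p + a0m), 2^-1 *: (a1p + a1m),
            2^-1 *: (a1p - a1m), 2^-1 *: (a0p - a0m)).
Proof.
rewrite /pglue /glue /Ppos /Pneg -!scalerAl !linearZ !linearD !linearN /= -!scalerAr.
rewrite !mulrDl !mulrDr !mulrN !mulNr !mul1r -[et j * e i * e i]mulrA e_sqr mulr1.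
move: (incl _ _ _) (incl _ _ _) (e i * _) (e i * _) (et j * incl _ _ _)
  (et j * incl _ _ _) (et j * e i * _) (et j * e i * _) => x1 x2 x3 x4 x5 x6 x7 x8.
by apply/ffunP=> U; rewrite !ffunE /GRing.scale /=; ring.
Qed.

Hypothesis hK : 2%N \notin [pchar K].

Let two_neq0 : 2 != 0 :> K.
Proof. by move: hK; rewrite !inE. Qed.

Let half_sum a b : 2^-1 *: ((a + b) + (a - b)) = a.
Proof. by rewrite addrACA subrr addr0 -mulr2n -scaler_nat scalerA mulVf ?scale1r. Qed.

Let half_dif a b : 2^-1 *: ((a + b) - (a - b)) = b.
Proof.
by rewrite opprB [a + b]addrC addrACA subrr addr0 -mulr2n -scaler_nat scalerA mulVf ?scale1r.
Qed.

Lemma pglue_onto (a : Cl K p.+1 q.+1) : exists w, a == pglue i j w.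
Proof.
have [[[[A00 A01] A10] A11] /eqP ->] := glue_onto i j a.
exists (A00 + A11, A01 + A10, A00 - A11, A01 - A10).
by rewrite pglueE !half_sum !half_dif.
Qed.

Lemma pglue_inj : injective (@pglue K p q i j).
Proof.
move=> [[[a0p a1p] a0m] a1m] [[[b0p b1p] b0m] b1m]; rewrite !pglueE => /glue_inj [].
have i2 : injective (fun x : Cl K p q => 2^-1 *: x).
  by apply: (can_inj (g := fun x => 2 *: x)) => x; rewrite scalerA mulfV ?scale1r.
move=> /i2 E0 /i2 E1 /i2 E2 /i2 E3.
have sol a b c d : a + b = c + d -> a - b = c - d -> a = c /\ b = d.
  move=> s t; split; first by rewrite -(half_sum a b) s t half_sum.
  by rewrite -(half_dif a b) s t half_dif.
by have [-> ->] := sol _ _ _ _ E0 E3; have [-> ->] := sol _ _ _ _ E1 E2.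
Qed.

End Pglue.

(* The decomposition of a exists because 2 is invertible (pglue_onto) and is
   unique (pglue_inj); PhiE is the defining equation. *)
Definition Phi {K : fieldType} (hK : 2%N \notin [pchar K]) {p q}
    (i : 'I_p.+1) (j : 'I_q.+1) (a : Cl K p.+1 q.+1) : 'M[Cl K p q]_2 :=
  let: (a0p, a1p, a0m, a1m) := xchoose (pglue_onto i j hK a) in
  mx2 a0p (alpha a1p) a1m (alpha a0m).

Lemma PhiE (K : fieldType) (hK : 2%N \notin [pchar K]) p q
    (i : 'I_p.+1) (j : 'I_q.+1) (a0p a1p a0m a1m : Cl K p q) :
  Phi hK i j (pglue i j (a0p, a1p, a0m, a1m)) =
  mx2 a0p (alpha a1p) a1m (alpha a0m).
Proof.
rewrite /Phi; set ex := pglue_onto _ _ _ _.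
by have /eqP/(pglue_inj hK) <- := xchooseP ex.
Qed.

(** ** The maps [F n] from Cl(n,n) to M_{2^n}(K) *)

Lemma expn2S n : (2 ^ n + 2 ^ n = 2 ^ n.+1)%N.
Proof. by rewrite addnn -mul2n expnS. Qed.

(* F0 and F_glue are the defining equations. *)
Fixpoint F {K : fieldType} (n : nat) : Cl K n n -> 'M[K]_(2 ^ n) :=
  match n return Cl K n n -> 'M[K]_(2 ^ n) with
  | 0 => fun a => (a set0)%:M
  | m.+1 => fun a =>
      let: (A00, A01, A10, A11) := xchoose (glue_onto ord_max ord_max a) in
      castmx (expn2S m, expn2S m)
        (block_mx (F (A00 + A11)) (F (alpha (A01 + A10)))
                  (F (A01 - A10)) (F (alpha (A00 - A11))))
  end.

Lemma cl00E (K : fieldType) (a : Cl K 0 0) : a = (a set0 : K) *: (1 : Cl K 0 0).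
Proof.
rewrite {1}[a]cl_sum_mon (bigD1 set0) //= big1 ?addr0 // => S /set0Pn[x _].
by case: x => -[].
Qed.

Lemma F0 (K : fieldType) (c : K) : F (c%:A : Cl K 0 0) = c%:M.
Proof. by rewrite /= !ffunE eqxx /GRing.scale /= mulr1. Qed.

Lemma F_glue (K : fieldType) n (A00 A01 A10 A11 : Cl K n n) :
  F (glue ord_max ord_max (A00, A01, A10, A11)) =
  castmx (expn2S n, expn2S n)
    (block_mx (F (A00 + A11)) (F (alpha (A01 + A10)))
              (F (A01 - A10)) (F (alpha (A00 - A11)))).
Proof.
have [g Eg] : {g | g = glue ord_max ord_max (A00, A01, A10, A11)} by eexists.
rewrite -Eg /=; set ex := glue_onto _ _ _.
by have /eqP := xchooseP ex; rewrite {1}Eg => /glue_inj <-.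
Qed.

(** * Algorithms over K

    A program works on an unbounded memory of cells holding elements of K,
    addressed by natural numbers, and on registers holding natural numbers
    which are used for addressing and control.  Only the instructions acting on
    memory cells are counted as operations. *)

Inductive iexp :=
  | IConst of nat
  | IReg of nat
  | IAdd of iexp & iexp
  | ISub of iexp & iexp
  | IMul of iexp & iexp
  | IDiv of iexp & iexp
  | IMod of iexp & iexp.

Inductive bexp :=
  | BLe of iexp & iexp
  | BNot of bexp
  | BAnd of bexp & bexp.

(* In the instructions on cells the arguments of type [iexp] are addresses, the
   first one being that of the cell which is modified. *)
Inductive prog (K : Type) :=
  | Skip
  | Seq of prog K & prog K
  | SetReg of nat & iexp
  | If of bexp & prog K & prog K
  | While of bexp & prog K
  | SetCst of iexp & K
  | Move of iexp & iexp
  | Neg of iexp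
  | Add of iexp & iexp & iexp
  | Sub of iexp & iexp & iexp
  | Mul of iexp & iexp & iexp
  | Div of iexp & iexp & iexp.

Arguments Skip {K}.
Arguments SetReg {K}.
Arguments Move {K}.
Arguments Neg {K}.
Arguments Add {K}.
Arguments Sub {K}.
Arguments Mul {K}.
Arguments Div {K}.

Record state (K : Type) := State { reg : nat -> nat; mem : nat -> K }.

Fixpoint ieval (r : nat -> nat) (x : iexp) : nat :=
  match x with
  | IConst k => k
  | IReg k => r k
  | IAdd x y => (ieval r x + ieval r y)%N
  | ISub x y => (ieval r x - ieval r y)%N
  | IMul x y => (ieval r x * ieval r y)%N
  | IDiv x y => (ieval r x %/ ieval r y)%N
  | IMod x y => (ieval r x %% ieval r y)%N
  end.

Fixpoint beval (r : nat -> nat) (b : bexp) : bool :=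
  match b with
  | BLe x y => (ieval r x <= ieval r y)%N
  | BNot b => ~~ beval r b
  | BAnd b c => beval r b && beval r c
  end.

Definition upd {T : Type} (f : nat -> T) (k : nat) (v : T) : nat -> T :=
  fun l => if l == k then v else f l.

Definition set_reg {K : Type} (s : state K) (k v : nat) : state K :=
  State (upd (reg s) k v) (mem s).

Definition addr {K : Type} (s : state K) (x : iexp) : nat := ieval (reg s) x.
Definition cell {K : Type} (s : state K) (x : iexp) : K := mem s (addr s x).
Definition store {K : Type} (s : state K) (x : iexp) (v : K) : state K :=
  State (reg s) (upd (mem s) (addr s x) v).

(* [exec P s t s']: started in state s, the program P halts in state s' after
   exactly t operations.  Division by zero has no transition. *)
Inductive exec {K : fieldType} : prog K -> state K -> nat -> state K -> Prop :=
  | ESkip s : exec Skip s 0 s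
  | ESeq P Q s t s1 u s2 :
      exec P s t s1 -> exec Q s1 u s2 -> exec (Seq P Q) s (t + u) s2
  | ESetReg k x s : exec (SetReg k x) s 0 (set_reg s k (ieval (reg s) x))
  | EIfTrue b P Q s t s1 :
      beval (reg s) b -> exec P s t s1 -> exec (If b P Q) s t s1
  | EIfFalse b P Q s t s1 :
      ~~ beval (reg s) b -> exec Q s t s1 -> exec (If b P Q) s t s1
  | EWhileTrue b P s t s1 u s2 :
      beval (reg s) b -> exec P s t s1 -> exec (While b P) s1 u s2 ->
      exec (While b P) s (t + u) s2
  | EWhileFalse b P s : ~~ beval (reg s) b -> exec (While b P) s 0 s
  | ESetCst x c s : exec (SetCst x c) s 1 (store s x c)
  | EMove x y s : exec (Move x y) s 1 (store s x (cell s y))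
  | ENeg x s : exec (Neg x) s 1 (store s x (- cell s x))
  | EAdd x y z s : exec (Add x y z) s 1 (store s x (cell s y + cell s z))
  | ESub x y z s : exec (Sub x y z) s 1 (store s x (cell s y - cell s z))
  | EMul x y z s : exec (Mul x y z) s 1 (store s x (cell s y * cell s z))
  | EDiv x y z s : cell s z != 0 ->
      exec (Div x y z) s 1 (store s x (cell s y / cell s z)).

(* Matrices are stored by rows in the cells 0, 1, ..., m^2 - 1. *)
Definition holds {K : Type} {m} (s : state K) (M : 'M[K]_m) : Prop :=
  forall r c : 'I_m, mem s (r * m + c)%N = M r c.

Lemma exec_det (K : fieldType) (P : prog K) s t s' u s'' :
  exec P s t s' -> exec P s u s'' -> t = u /\ s' = s''.
Proof.
move=> E; elim: E u s'' => {P s t s'}; try by move=> *; match goal with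
  H : exec _ _ _ _ |- _ => inversion H end.
- move=> P Q s t s1 u s2 _ IH1 _ IH2 v s'' E.
  inversion E as [|? ? ? t' s1' u' ? E1 E2| | | | | | | | | | | |]; subst.
  by have [? ?] := IH1 _ _ E1; subst; have [-> ->] := IH2 _ _ E2.
- move=> b P Q s t s1 hb _ IH u s'' E.
  by inversion E; subst; [apply: IH | match goal with H : is_true (~~ _) |- _ => rewrite hb in H end].
- move=> b P Q s t s1 hb _ IH u s'' E.
  by inversion E; subst; [match goal with H : is_true (beval _ _) |- _ => rewrite H in hb end | apply: IH].
- move=> b P s t s1 u s2 hb _ IH1 _ IH2 v s'' E.
  inversion E as [| | | | |? ? ? t' s1' u' ? hb' E1 E2|? ? ? hb'| | | | | | |]; subst;
    last by rewrite hb in hb'.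
  by have [? ?] := IH1 _ _ E1; subst; have [-> ->] := IH2 _ _ E2.
- move=> b P s hb u s'' E.
  by inversion E as [| | | | |? ? ? t' s1' u' ? hb' E1 E2| | | | | | | |]; subst;
    rewrite // hb' in hb.
Qed.

(* Main.v *)
Require Import Defs.
From mathcomp Require Import all_boot all_order all_algebra.
From mathcomp Require Import zify.

Set Implicit Arguments.
Unset Strict Implicit.
Unset Printing Implicit Defensive.

Import GRing.Theory.
Local Open Scope ring_scope.

(** The formula for [Phi (beta a)] holds because [beta] exchanges the idempotents
    P_+ and P_- and fixes e.  Unfolding the recursion, it says that F_n (beta a) is
    F_n a with both the rows and the columns listed in reverse order, up to signs:
    at each level the quadrants are reversed and alpha, which acts on F_n by the
    sign (-1)^(number of binary digits 1 of r and c), is applied once.  The total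
    sign of the entry (r, c) is (-1)^(beta_wt n r + beta_wt n c).  Its exponent is
    computed in registers, so that writing the new matrix to the old place via a
    scratch copy takes at most 3 operations per entry. *)

(** * Action of [beta] and [alpha] on the two decompositions of Cl(p+1,q+1) *)

Section BetaPhi.
Variables (K : fieldType) (p q : nat) (i : 'I_p.+1) (j : 'I_q.+1).
Implicit Types a : Cl K p q.

Lemma alpha_beta a : alpha (beta a) = beta (alpha a).
Proof. by apply/ffunP=> S; rewrite !ffunE mulrCA. Qed.

Lemma beta_incl a : beta (incl i j a) = incl i j (beta a).
Proof.
elim/bvec_ind: a => [|[k|k]|a b IHa IHb|k a b IHa IHb].
- by rewrite !rmorph1.
- by rewrite -/(e k) beta_e incl_e beta_e.
- by rewrite -/(et k) beta_et rmorphN /= incl_et beta_et.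
- by rewrite !rmorphM /= IHa IHb.
- by rewrite !linearP /= IHa IHb.
Qed.

Lemma alpha_incl a : alpha (incl i j a) = incl i j (alpha a).
Proof.
elim/bvec_ind: a => [|[k|k]|a b IHa IHb|k a b IHa IHb].
- by rewrite !rmorph1.
- by rewrite -/(e k) alpha_e rmorphN /= incl_e alpha_e.
- by rewrite -/(et k) alpha_et rmorphN /= incl_et alpha_et.
- by rewrite !rmorphM /= IHa IHb.
- by rewrite !linearP /= IHa IHb.
Qed.

Lemma beta_Ppos : beta (Ppos i j) = Pneg i j :> Cl K p.+1 q.+1.
Proof. by rewrite /Ppos /Pneg linearZ rmorphD rmorphM rmorph1 /= beta_e beta_et mulNr. Qed.

Lemma beta_Pneg : beta (Pneg i j) = Ppos i j :> Cl K p.+1 q.+1.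
Proof. by rewrite -beta_Ppos betaK. Qed.

Lemma beta_pglue (a0p a1p a0m a1m : Cl K p q) :
  beta (pglue i j (a0p, a1p, a0m, a1m)) =
  pglue i j (beta a0m, beta a1m, beta a0p, beta a1p).
Proof.
rewrite /pglue !rmorphD !rmorphM /= !beta_incl beta_Ppos beta_Pneg beta_e.
by rewrite -addrA addrC addrA.
Qed.

Lemma beta_glue (A00 A01 A10 A11 : Cl K p q) :
  beta (glue i j (A00, A01, A10, A11)) =
  glue i j (beta A00, beta A01, - beta A10, - beta A11).
Proof.
rewrite /glue !rmorphD !rmorphM /= !beta_incl beta_e beta_et !rmorphN /=.
by rewrite !mulNr !mulrN.
Qed.

Lemma alpha_glue (A00 A01 A10 A11 : Cl K p q) :
  alpha (glue i j (A00, A01, A10, A11)) =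
  glue i j (alpha A00, - alpha A01, - alpha A10, alpha A11).
Proof.
rewrite /glue !rmorphD !rmorphM /= !alpha_incl alpha_e alpha_et !rmorphN /=.
by rewrite !(mulNr, mulrN) opprK.
Qed.

Lemma glueN (A00 A01 A10 A11 : Cl K p q) :
  - glue i j (A00, A01, A10, A11) = glue i j (- A00, - A01, - A10, - A11).
Proof. by rewrite /glue !rmorphN /= !mulrN !opprD. Qed.

End BetaPhi.

(* Only the parity of [wsum] matters, and [x %/ 2 ^ k] has the parity of the k-th
   binary digit of x. *)
Definition wsum (f : nat -> nat) (n x : nat) : nat := \sum_(k < n) (x %/ 2 ^ k * f k)%N.
Definition alpha_wt (n x : nat) : nat := wsum (fun=> 1%N) n x.
Definition beta_wt (n x : nat) : nat := wsum (fun k => n - 1 - k)%N n x.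

(** * Parity rules for the sign exponents *)

Lemma wsumS f n x : wsum f n.+1 x = (wsum f n x + x %/ 2 ^ n * f n)%N.
Proof. exact: big_ord_recr. Qed.

(** For k < n, adding 2^n to x raises [x %/ 2 ^ k] by 2^(n-k), which is even: the top digit is
    invisible to the lower positions. *)
Lemma odd_wsum_add f n x : odd (wsum f n (2 ^ n + x)) = odd (wsum f n x).
Proof.
rewrite /wsum !(big_morph odd oddD (erefl _)); apply: eq_bigr => k _.
rewrite !oddM divnDl ?dvdn_exp2l ?(ltnW (ltn_ord k)) // oddD -expnB ?(ltnW (ltn_ord k)) //.
by rewrite oddX subn_eq0 leqNgt ltn_ord.
Qed.

(** Each coefficient n - 1 - k grows by one, and the new position n enters with coefficient 0. This
    matches the single [alpha] applied at each level of the recursion. *)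
Lemma beta_wtS n x : beta_wt n.+1 x = (beta_wt n x + alpha_wt n x)%N.
Proof.
rewrite /beta_wt /alpha_wt wsumS subSS subn0 subnn muln0 addn0 -big_split.
by apply: eq_bigr => k _ /=; have := ltn_ord k; nia.
Qed.

(** * Quadrants of the matrix and the top binary digit of an index *)

Section MatrixBlocks.
Variables (K : fieldType) (n : nat).

Definition lo (r : 'I_(2 ^ n)) : 'I_(2 ^ n.+1) := cast_ord (expn2S n) (lshift _ r).
Definition hi (r : 'I_(2 ^ n)) : 'I_(2 ^ n.+1) := cast_ord (expn2S n) (rshift _ r).

Lemma lo_hiP (P : 'I_(2 ^ n.+1) -> Prop) :
  (forall r, P (lo r)) -> (forall r, P (hi r)) -> forall r, P r.
Proof.
move=> Plo Phi r; rewrite -(cast_ordKV (expn2S n) r).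
by case: (split_ordP (cast_ord (esym (expn2S n)) r)) => k ->; [apply: Plo | apply: Phi].
Qed.

Lemma rev_lo r : rev_ord (lo r) = hi (rev_ord r).
Proof. by apply: val_inj => /=; have := expn2S n; have := ltn_ord r; lia. Qed.

Lemma rev_hi r : rev_ord (hi r) = lo (rev_ord r).
Proof. by apply: val_inj => /=; have := expn2S n; have := ltn_ord r; lia. Qed.

Lemma odd_alpha_wt_lo r : odd (alpha_wt n.+1 (lo r)) = odd (alpha_wt n r).
Proof. by rewrite /alpha_wt wsumS /= divn_small ?addn0. Qed.

Lemma odd_alpha_wt_hi r : odd (alpha_wt n.+1 (hi r)) = ~~ odd (alpha_wt n r).
Proof.
rewrite /alpha_wt wsumS oddD /= odd_wsum_add divnDl // divnn expn_gt0 /=.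
by rewrite divn_small // addbT.
Qed.

Lemma odd_beta_wt_lo r :
  odd (beta_wt n.+1 (lo r)) = odd (beta_wt n r) (+) odd (alpha_wt n r).
Proof. by rewrite beta_wtS oddD. Qed.

Lemma odd_beta_wt_hi r :
  odd (beta_wt n.+1 (hi r)) = odd (beta_wt n r) (+) odd (alpha_wt n r).
Proof. by rewrite beta_wtS oddD /= /beta_wt /alpha_wt !odd_wsum_add. Qed.

Variables A00 A01 A10 A11 : Cl K n n.
Let Fg := F (glue ord_max ord_max (A00, A01, A10, A11)).

Lemma F_lolo r c : Fg (lo r) (lo c) = F (A00 + A11) r c.
Proof. by rewrite /Fg F_glue castmxE !cast_ordK block_mxEul. Qed.
Lemma F_lohi r c : Fg (lo r) (hi c) = F (alpha (A01 + A10)) r c.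
Proof. by rewrite /Fg F_glue castmxE !cast_ordK block_mxEur. Qed.
Lemma F_hilo r c : Fg (hi r) (lo c) = F (A01 - A10) r c.
Proof. by rewrite /Fg F_glue castmxE !cast_ordK block_mxEdl. Qed.
Lemma F_hihi r c : Fg (hi r) (hi c) = F (alpha (A00 - A11)) r c.
Proof. by rewrite /Fg F_glue castmxE !cast_ordK block_mxEdr. Qed.
Definition F_blocks := (F_lolo, F_lohi, F_hilo, F_hihi).
End MatrixBlocks.

(** * Entries of [F] under negation, [alpha] and [beta] *)

Section Entries.
Variable K : fieldType.

(** Reduces signs to booleans, so that sign identities become finite case checks. *)
Lemma signr_addn (m n : nat) : (-1) ^+ (m + n) = (-1) ^+ (odd m (+) odd n) :> K.
Proof. by rewrite -oddD signr_odd. Qed.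

(** Extracts the sign that [alpha_glue] leaves on the coordinates A01 and A10. *)
Lemma F_opp n (a : Cl K n n) r c : F (- a) r c = - F a r c.
Proof.
elim: n a r c => [|n IH] a r c; first by rewrite !ord1 !mxE !ffunE.
have [[[[A00 A01] A10] A11] /eqP ->] := glue_onto ord_max ord_max a.
by rewrite glueN; elim/lo_hiP: r => r; elim/lo_hiP: c => c;
  rewrite !F_blocks -IH -?rmorphN ?opprD.
Qed.

(** The off-diagonal quadrants gain a minus sign, and they are those where exactly one of r and c
    has top digit 1. The induction hypothesis accounts for the lower digits. *)
Lemma F_alpha n (a : Cl K n n) r c :
  F (alpha a) r c = (-1) ^+ (alpha_wt n r + alpha_wt n c) * F a r c.
Proof.
elim: n a r c => [|n IH] a r c.
  by rewrite [r]ord1 [c]ord1 /alpha_wt /wsum !big_ord0 !mxE !ffunE big_set0.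
have [[[[A00 A01] A10] A11] /eqP ->] := glue_onto ord_max ord_max a.
have E0 : alpha A00 + alpha A11 = alpha (A00 + A11) by rewrite rmorphD.
have E1 : alpha (- alpha A01 + - alpha A10) = - (A01 + A10).
  by rewrite -opprD -rmorphD rmorphN /= alphaK.
have E2 : - alpha A01 - - alpha A10 = - alpha (A01 - A10).
  by rewrite rmorphB opprB opprK addrC.
have E3 : alpha A00 - alpha A11 = alpha (A00 - A11) by rewrite rmorphB.
rewrite alpha_glue !signr_addn; elim/lo_hiP: r => r; elim/lo_hiP: c => c;
  rewrite !F_blocks ?E0 ?E1 ?E2 ?E3 ?F_opp ?IH !signr_addn
    ?odd_alpha_wt_lo ?odd_alpha_wt_hi;
  by case: (odd _) (odd _) => [] []; rewrite /= ?expr0 ?expr1 ?mulN1r ?mul1r ?opprK.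
Qed.

(** Between a quadrant of [F (beta a)] and the opposite quadrant of [F a], exactly one side carries
    an [alpha]; its sign is the increment of [beta_wt] given by [beta_wtS]. *)
Lemma F_beta n (a : Cl K n n) r c :
  F (beta a) r c = (-1) ^+ (beta_wt n r + beta_wt n c) * F a (rev_ord r) (rev_ord c).
Proof.
elim: n a r c => [|n IH] a r c.
  by rewrite [r]ord1 [c]ord1 /beta_wt /wsum !big_ord0 !mxE !ffunE big_set0.
have [[[[A00 A01] A10] A11] /eqP ->] := glue_onto ord_max ord_max a.
have E0 : beta A00 - - beta A11 = beta (A00 + A11) by rewrite rmorphD opprK.
have E1 : beta A01 - - beta A10 = beta (A01 + A10) by rewrite rmorphD opprK.
have E2 : beta A01 - beta A10 = beta (A01 - A10) by rewrite rmorphB.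
have E3 : beta A00 - beta A11 = beta (A00 - A11) by rewrite rmorphB.
(* For the quadrants with [alpha] on the right-hand side: x is written as [alpha (alpha x)] and the
   outer [alpha] is moved past [beta]. *)
have betaF (x : Cl K n n) r0 c0 : F (beta x) r0 c0 =
    (-1) ^+ (alpha_wt n r0 + alpha_wt n c0) *
    ((-1) ^+ (beta_wt n r0 + beta_wt n c0) * F (alpha x) (rev_ord r0) (rev_ord c0)).
  by rewrite -IH -F_alpha alpha_beta alphaK.
rewrite beta_glue !signr_addn; elim/lo_hiP: r => r; elim/lo_hiP: c => c;
  rewrite ?rev_lo ?rev_hi !F_blocks ?E0 ?E1 ?E2 ?E3;
  (* Restricting to the left-hand side leaves an [alpha] on the right untouched, so both sides end
     in the same entry. *)
  rewrite 1?[LHS]betaF 1?[LHS]F_alpha ?IH !signr_addn ?odd_beta_wt_lo ?odd_beta_wt_hi;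
  by case: (odd _) (odd _) (odd _) (odd _) => [] [] [] [];
    rewrite /= ?expr0 ?expr1 ?mulN1r ?mul1r ?opprK.
Qed.
End Entries.

(** * Rules for correctness with a cost bound *)

Section Runs.
Variable K : fieldType.
Implicit Types (P Q : prog K) (s : state K) (c d : nat).

(** A total-correctness Hoare triple from a fixed initial state, with c an upper bound on the
    cost. *)
Definition runs P c s (Post : state K -> Prop) : Prop :=
  exists t s', [/\ exec P s t s', Post s' & (t <= c)%N].

Lemma runs_exec P c s s' (Post : state K -> Prop) :
  exec P s c s' -> Post s' -> runs P c s Post.
Proof. by exists c, s'. Qed.

Lemma runs_seq P Q c d s (Mid Post : state K -> Prop) :
  runs P c s Mid -> (forall s', Mid s' -> runs Q d s' Post) ->
  runs (Seq P Q) (c + d) s Post.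
Proof.
move=> [t [s1 [E1 H1 l1]]] /(_ s1 H1) [u [s2 [E2 H2 l2]]].
by exists (t + u)%N, s2; split; [exact: ESeq E1 E2 | | exact: leq_add].
Qed.

Lemma runs_step P Q c d s s' (Post : state K -> Prop) :
  exec P s c s' -> runs Q d s' Post -> runs (Seq P Q) (c + d) s Post.
Proof. by move=> E R; apply: (runs_seq (Mid := eq s')) => [|_ <-] //; apply: runs_exec E _. Qed.

(** Induction on the number m of passes that remain. *)
Lemma runs_for b P c N s (Inv : nat -> state K -> Prop) :
  (forall k s', (k <= N)%N -> Inv k s' -> beval (reg s') b = (k < N)%N) ->
  (forall k s', (k < N)%N -> Inv k s' -> runs P c s' (Inv k.+1)) ->
  Inv 0%N s -> runs (While b P) (N * c) s (Inv N).
Proof.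
move=> hb hP I0.
suff W m k s' : (k + m = N)%N -> Inv k s' -> runs (While b P) (m * c) s' (Inv N).
  by apply: (W N 0%N s).
elim: m k s' => [|m IH] k s' km Ik.
  rewrite addn0 in km; rewrite mul0n -km.
  apply: runs_exec (Ik); apply: EWhileFalse.
  by rewrite (hb k) ?km ?ltnn // -km.
have ltkN : (k < N)%N by lia.
have [t [s1 [E1 I1 l1]]] := hP k s' ltkN Ik.
have [|u [s2 [E2 I2 l2]]] := IH k.+1 s1 _ I1; first by lia.
exists (t + u)%N, s2; split=> //; last by rewrite mulSn leq_add.
by apply: EWhileTrue E1 E2; rewrite (hb k) // ltnW.
Qed.

End Runs.

(** * The program *)

Section Program.
Variable K : fieldType.

Notation R k := (IReg k).
Notation N k := (IConst k).
Local Notation "x ;; y" := (Seq x y) (at level 60, right associativity).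
Definition lt_exp x y := BLe (IAdd x (N 1)) y.

(* Registers: 0 holds n, 1 holds 2^n, 2 holds 4^n, 3 is the index of the
   current entry, 4 a bit position, 5 the corresponding power of 2 and 6 the
   exponent of the sign. *)
Definition init_prog : prog K :=
  SetReg 1 (N 1) ;; SetReg 4 (N 0) ;;
  While (lt_exp (R 4) (R 0))
    (SetReg 1 (IMul (N 2) (R 1)) ;; SetReg 4 (IAdd (R 4) (N 1))).

(** The scratch copy keeps entries that the reversal would overwrite before they are read. *)
Definition copy_prog : prog K :=
  SetReg 2 (IMul (R 1) (R 1)) ;; SetReg 3 (N 0) ;;
  While (lt_exp (R 3) (R 2))
    (Move (IAdd (R 2) (R 3)) (R 3) ;; SetReg 3 (IAdd (R 3) (N 1))).

(** The entry with index k lies in row [k %/ 2 ^ n] and column [k %% 2 ^ n]; both weights are summed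
    in one loop, on registers only. *)
Definition sign_prog : prog K :=
  SetReg 4 (N 0) ;; SetReg 5 (N 1) ;; SetReg 6 (N 0) ;;
  While (lt_exp (R 4) (R 0))
    (SetReg 6 (IAdd (R 6)
       (IAdd (IMul (IDiv (IDiv (R 3) (R 1)) (R 5)) (ISub (ISub (R 0) (N 1)) (R 4)))
             (IMul (IDiv (IMod (R 3) (R 1)) (R 5)) (ISub (ISub (R 0) (N 1)) (R 4))))) ;;
     SetReg 5 (IMul (N 2) (R 5)) ;; SetReg 4 (IAdd (R 4) (N 1))).

(** Reversing rows and columns sends index k to 4^n - 1 - k, whose scratch copy is at 2 * 4^n - 1 -
    k. *)
Definition write_prog : prog K :=
  SetReg 3 (N 0) ;;
  While (lt_exp (R 3) (R 2))
    (sign_prog ;;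
     Move (R 3) (ISub (ISub (IAdd (R 2) (R 2)) (N 1)) (R 3)) ;;
     If (BLe (N 1) (IMod (R 6) (N 2))) (Neg (R 3)) Skip ;;
     SetReg 3 (IAdd (R 3) (N 1))).

Definition beta_prog : prog K := init_prog ;; copy_prog ;; write_prog.

(** * Correctness and cost of the program *)

Lemma init_prog_runs n (s : state K) : reg s 0 = n ->
  runs init_prog 0 s (fun s' =>
    [/\ reg s' 0 = n, reg s' 1 = 2 ^ n & Defs.mem s' = Defs.mem s]%N).
Proof.
move=> r0.
apply: runs_step (ESetReg _ _ _) _; apply: runs_step (ESetReg _ _ _) _.
pose Inv k (s' : state K) :=
  [/\ reg s' 0 = n, reg s' 1 = 2 ^ k, reg s' 4 = k & Defs.mem s' = Defs.mem s]%N.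
suff [t [s' [E [? ? _ ?] l]]] : runs (While (lt_exp (R 4) (R 0))
    (SetReg 1 (IMul (N 2) (R 1)) ;; SetReg 4 (IAdd (R 4) (N 1)))) (n * 0)
    (set_reg (set_reg s 1 (ieval (reg s) (N 1))) 4 0) (Inv n).
  by exists t, s'; rewrite muln0 in l.
apply: runs_for => [k s' _ [H0 H1 H4 _]|k s' _ [H0 H1 H4 Hm]|]; last by split.
  by rewrite /= H0 H4 addn1.
apply: runs_step (ESetReg _ _ _) _; apply: runs_exec (ESetReg _ _ _) _.
by split; rewrite //= ?H1 ?expnS // /upd /= H4 addn1.
Qed.

Lemma copy_prog_runs n (s : state K) : (reg s 0 = n -> reg s 1 = 2 ^ n ->
  runs copy_prog (4 ^ n) s (fun s' =>
    [/\ reg s' 0 = n, reg s' 1 = 2 ^ n, reg s' 2 = 4 ^ n &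
    forall k, (k < 4 ^ n)%N -> Defs.mem s' (4 ^ n + k)%N = Defs.mem s k]))%N.
Proof.
move=> r0 r1.
apply: runs_step (ESetReg _ _ _) _; apply: runs_step (ESetReg _ _ _) _.
have W4 : (4 ^ n = 2 ^ n * 2 ^ n)%N by rewrite -expnMn.
pose Inv k (s' : state K) :=
  [/\ [/\ reg s' 0 = n, reg s' 1 = 2 ^ n, reg s' 2 = 4 ^ n & reg s' 3 = k],
   forall l, l < k -> Defs.mem s' (4 ^ n + l) = Defs.mem s l &
   forall l, l < 4 ^ n -> Defs.mem s' l = Defs.mem s l]%N.
set s0 := set_reg _ _ _; set prg := While _ _.
suff [t [s' [E [[? ? ? ?] ? ?] l]]] : runs prg (4 ^ n * 1) s0 (Inv (4 ^ n)%N).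
  by exists t, s'; rewrite muln1 in l.
apply: runs_for => [k s' _ [[_ _ H2 H3] _ _]|k s' lk [[H0 H1 H2 H3] Hc Hm]|].
- by rewrite /= H2 H3 addn1.
- apply: (@runs_step _ _ _ 1 0); first exact: EMove.
  apply: runs_exec (ESetReg _ _ _) _.
  split; first by split; rewrite //= /upd /= H3 addn1.
  + move=> l; rewrite ltnS leq_eqVlt /= /upd /cell /addr /= H2 H3 eqn_add2l.
    by case: eqVneq => [-> _|_ /Hc] //; rewrite Hm.
  + move=> l ll; rewrite /= /upd /addr /= H2 H3.
    by case: eqP => [|_]; [lia | exact: Hm].
- by split=> //; split; rewrite //= /upd /= r1 -W4.
Qed.

Lemma sign_prog_runs n k (s : state K) :
  (reg s 0 = n -> reg s 1 = 2 ^ n -> reg s 2 = 4 ^ n -> reg s 3 = k ->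
  runs sign_prog 0 s (fun s' =>
    [/\ [/\ reg s' 0 = n, reg s' 1 = 2 ^ n, reg s' 2 = 4 ^ n & reg s' 3 = k],
    reg s' 6 = beta_wt n (k %/ 2 ^ n) + beta_wt n (k %% 2 ^ n) & Defs.mem s' = Defs.mem s]))%N.
Proof.
move=> r0 r1 r2 r3.
do 3!apply: runs_step (ESetReg _ _ _) _.
(* The coefficients n - 1 - b stay fixed while the length l grows, so the partial sums are values of
   [wsum], not of [beta_wt] at l. *)
pose Inv l (s' : state K) :=
  [/\ [/\ reg s' 0 = n, reg s' 1 = 2 ^ n, reg s' 2 = 4 ^ n & reg s' 3 = k],
   [/\ reg s' 4 = l, reg s' 5 = 2 ^ l &
    reg s' 6 = wsum (fun b => n - 1 - b) l (k %/ 2 ^ n)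
               + wsum (fun b => n - 1 - b) l (k %% 2 ^ n)]
   & Defs.mem s' = Defs.mem s]%N.
set s0 := set_reg _ _ _; set prg := While _ _.
suff [t [s' [E [? [_ _ ?] ?] l]]] : runs prg (n * 0) s0 (Inv n).
  by exists t, s'; rewrite muln0 in l.
apply: runs_for => [l s' _ [[H0 _ _ _] [H4 _ _] _]|l s' ll [[H0 H1 H2 H3] [H4 H5 H6] Hm]|].
- by rewrite /= H0 H4 addn1.
- do 2!apply: runs_step (ESetReg _ _ _) _.
  apply: runs_exec (ESetReg _ _ _) _.
  split; [by split | split | by []]; rewrite /= /upd /=.
  + by rewrite H4 addn1.
  + by rewrite H5 expnS.
  + by rewrite !wsumS H0 H1 H3 H4 H5 H6 addnACA.
- by split=> //; split; rewrite // /= /upd /= /wsum !big_ord0.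
Qed.

Lemma write_prog_runs n (s : state K) :
  reg s 0 = n -> reg s 1 = (2 ^ n)%N -> reg s 2 = (4 ^ n)%N ->
  runs write_prog (4 ^ n * 2)%N s (fun s' => forall k, (k < 4 ^ n)%N ->
    Defs.mem s' k = (-1) ^+ (beta_wt n (k %/ 2 ^ n) + beta_wt n (k %% 2 ^ n))
               * Defs.mem s (4 ^ n + 4 ^ n - 1 - k)%N).
Proof.
move=> r0 r1 r2.
apply: runs_step (ESetReg _ _ _) _.
(* The last clause protects the scratch copy: all writes go below 4^n. *)
pose Inv k (s' : state K) :=
  [/\ [/\ reg s' 0 = n, reg s' 1 = 2 ^ n, reg s' 2 = 4 ^ n & reg s' 3 = k],
   forall l, l < k -> Defs.mem s' l = ((-1) ^+ (beta_wt n (l %/ 2 ^ n) + beta_wt n (l %% 2 ^ n))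
               * Defs.mem s (4 ^ n + 4 ^ n - 1 - l)%N)%R &
   forall l, 4 ^ n <= l -> Defs.mem s' l = Defs.mem s l]%N.
set s0 := set_reg _ _ _; set prg := While _ _.
suff [t [s' [E [_ Hc _] l]]] : runs prg (4 ^ n * 2) s0 (Inv (4 ^ n)%N).
  by exists t, s'.
apply: runs_for => [k s' _ [[_ _ H2 H3] _ _]|k s' lk [[H0 H1 H2 H3] Hc Hm]|].
- by rewrite /= H2 H3 addn1.
- apply: (@runs_seq _ _ _ 0 2); first exact: sign_prog_runs H0 H1 H2 H3.
  move=> s1 [[{}H0 {}H1 {}H2 {}H3] H6 Em]; rewrite -{s'}Em in Hc Hm.
  apply: (@runs_step _ _ _ 1 1); first exact: EMove.
  set s2 := store _ _ _.
  (* The parity b is both the condition for [Neg] and the cost of the conditional; with the move, a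
     pass costs at most 2. *)
  have [b Eb] : {b | b = odd (reg s1 6)} by eexists.
  pose s3 := if b then store s2 (R 3) (- cell s2 (R 3)) else s2.
  have E3 : exec (If (BLe (N 1) (IMod (R 6) (N 2))) (Neg (R 3)) Skip) s2 b s3.
    have Ec : beval (reg s2) (BLe (N 1) (IMod (R 6) (N 2))) = b.
      by rewrite /= Eb modn2; case: (odd _).
    rewrite /s3; case: b Ec {Eb s3} => Ec.
      by apply: EIfTrue => //; exact: ENeg.
    by apply: EIfFalse; rewrite ?Ec //; exact: ESkip.
  have [t [s' [E4 Is' lt]]] : runs (If (BLe (N 1) (IMod (R 6) (N 2))) (Neg (R 3)) Skip ;;
     SetReg 3 (IAdd (R 3) (N 1))) (b + 0) s2 (Inv k.+1); last first.
    by exists t, s'; split=> //; rewrite (leq_trans lt) // addn0 leq_b1.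
  apply: runs_step E3 _; apply: runs_exec (ESetReg _ _ _) _.
  have reg3 l : reg s3 l = reg s1 l by rewrite /s3; case: (b).
  have mem3 l : Defs.mem s3 l =
      if l == k then (-1) ^+ b * Defs.mem s1 (4 ^ n + 4 ^ n - 1 - k)%N
      else Defs.mem s1 l.
    rewrite /s3; case: (b); rewrite /= /upd /cell /addr /= /upd /cell /addr /= H2 H3 ?eqxx.
      by case: eqP => // _; rewrite expr1 mulN1r.
    by case: eqP => // _; rewrite expr0 mul1r.
  split.
  + by split; rewrite /= /upd /= reg3 // H3 addn1.
  + move=> l; rewrite ltnS leq_eqVlt /= mem3.
    case: eqVneq => [-> _|_ /= /Hc //].
    by rewrite -H6 Eb signr_odd Hm //; lia.
  + move=> l ll; rewrite /= mem3; case: eqP => [|_]; [lia | exact: Hm].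
- by split=> //; split.
Qed.

Lemma beta_prog_runs n (a : Cl K n n) (s : state K) :
  reg s 0 = n -> holds s (F a) ->
  runs beta_prog (3 * 4 ^ n) s (fun s' => holds s' (F (beta a))).
Proof.
move=> r0 Hs; have -> : (3 * 4 ^ n = 0 + (4 ^ n + 4 ^ n * 2))%N by lia.
apply: runs_seq (init_prog_runs r0) _ => s1 [{}r0 r1 Em].
apply: runs_seq (copy_prog_runs r0 r1) _ => s2 [{}r0 {}r1 r2 Hc].
have [t [s' [E Hw l]]] := write_prog_runs r0 r1 r2.
exists t, s'; split=> // r c.
have W4 : (4 ^ n = 2 ^ n * 2 ^ n)%N by rewrite -expnMn.
have lr := ltn_ord r; have lc := ltn_ord c.
have lk : (r * 2 ^ n + c < 4 ^ n)%N by rewrite W4; nia.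
rewrite Hw // divnMDl ?expn_gt0 // divn_small // addn0 modnMDl modn_small //.
rewrite F_beta; congr (_ * _).
(* As 4^n = 2^n * 2^n, reversing both coordinates reverses the linear index. *)
have -> : (4 ^ n + 4 ^ n - 1 - (r * 2 ^ n + c) = 4 ^ n + (rev_ord r * 2 ^ n + rev_ord c))%N.
  by rewrite /= W4 in lk *; nia.
have lr' := ltn_ord (rev_ord r); have lc' := ltn_ord (rev_ord c).
by rewrite Hc ?Em ?Hs // W4; nia.
Qed.

End Program.

Theorem mainTheorem6 :
  (forall (K : fieldType) (hK : 2%N \notin [pchar K]) (p q : nat)
      (i : 'I_p.+1) (j : 'I_q.+1)
      (a : Cl K p.+1 q.+1) (a0p a1p a0m a1m : Cl K p q),
    a = Ppos i j * incl i j a0p + Ppos i j * e i * incl i j a1p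
        + Pneg i j * incl i j a0m + Pneg i j * e i * incl i j a1m ->
    Phi hK i j (beta a) =
      mx2 (beta a0m) (alpha (beta a1m)) (beta a1p) (alpha (beta a0p)))
  /\
  (exists C : nat, forall K : fieldType, 2%N \notin [pchar K] ->
    exists P : prog K, forall n : nat, (1 <= n)%N ->
    forall (a : Cl K n n) (s : state K),
      reg s 0%N = n -> holds s (F a) ->
      exists (t : nat) (s' : state K),
        [/\ exec P s t s', holds s' (F (beta a)) & (t <= C * (n * 4 ^ n))%N]).
Proof.
split=> [K hK p q i j a a0p a1p a0m a1m ->|].
  by rewrite -[X in beta X]/(pglue i j (a0p, a1p, a0m, a1m)) beta_pglue PhiE.
(* One operation per entry for the copy, at most two for the write; n >= 1 then gives 3 * 4^n <= 3 *
   (n * 4^n). *)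
exists 3%N => K _; exists (beta_prog K) => n n_gt0 a s r0 Hs.
have [t [s' [E Hs' lt]]] := beta_prog_runs r0 Hs.
by exists t, s'; split=> //; rewrite (leq_trans lt) // leq_mul2l leq_pmull.
Qed.
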